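(* In each of the following cases (i)–(v), there exists a random subset $G$ of $E$ such that $\varphi_\omega(G_\omega)\subseteq G_{\theta\omega}$ a.s. and such that $H_\omega=\bigcap_{n\ge1}\Phi^n_\omega(G_{\theta^{-n}\omega})$ satisfies $\mathbf P[H\text{ is finite and non-empty}]>0$; consequently there exists a stationary extension $(\tilde\Omega,\tilde{\mathcal F},\tilde{\mathbf P},\tilde\theta)$ of $(\Omega,\mathcal F,\mathbf P,\theta)$, with $\tilde\Omega=\{(\omega,x)\in\Omega\times E: x\in H_\omega\}$ and $\tilde\theta(\omega,x)=(\theta\omega,\varphi_\omega(x))$, on which the equation $X\circ\theta=\varphi(X)$ is solved by $\tilde X(\omega,x)=x$, i.e. $\tilde X(\tilde\theta(\omega,x))=\varphi_\omega(\tilde X(\omega,x))$, $\tilde{\mathbf P}$-a.s. (i) Some deterministic finite subset $F$ of $E$ is a.s. stable by $\varphi$. (ii) The random map $\varphi$ is itself a.s. continuous and $\preceq$-non-decreasing. (iii) (H1) holds and, for some solution $Y$ of $Y\circ\theta=\psi(Y)$, $\mathbf P[Y\preceq 0_E]>0$. In this case, moreover, a unique $E$-valued solution $X$ of $X\circ\theta=\varphi(X)$ a.s. exists on the original probability space, to which all sequences $\{X_{Z,n}\}_{n\in\mathbb N}$ with $Z\preceq Y$ a.s. converge with strong backwards coupling. (iv) (H1) and (H3) hold. (v) For some collection $\mathcal G$ of $E$-valued random variables, there exist an integer $p$, a finite random set $B$ and an event $\mathcal B$ of positive probability such that for all $Z\in\mathcal G$ and all $n\ge p$, $$X_{Z,n}\in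 B\circ\theta^n\quad\text{on }\theta^{-n}\mathcal B .$$ If additionally $\mathbf P[\mathrm{Card}\,B=1]>0$, then a solution $X$ of $X\circ\theta=\varphi(X)$ a.s. exists on the original space, to which all sequences $\{X_{Z,n}\}_{n\in\mathbb N}$, $Z\in\mathcal G$, converge with strong backwards coupling.
   Context: $E$ is a Polish space with Borel $\sigma$-field $\mathcal E$, endowed with a partial order $\preceq$ having a $\preceq$-minimal point $0_E$, and such that any $\preceq$-increasing sequence converges (possibly to an element of the adherence of $E$). A subset $A\subset E$ is locally finite if $A\cap C$ is finite for every compact $C\subset E$. $(\Omega,\mathcal F,\mathbf P,\theta)$ is a stationary ergodic dynamical system: a probability space with a measurable bijection $\theta$ with measurable inverse, $\mathbf P$ being $\theta$-invariant and every $\theta$-invariant event having probability $0$ or $1$. $\varphi$ is a random variable with values in the set of measurable maps from $E$ to itself; $\varphi_\omega$ is its value at $\omega$. A set $S\subset E$ is a.s. stable by $\varphi$ if $\varphi_\omega(S)\subset S$ a.s. For an $E$-valued random variable $Z$, $X_{Z,0}=Z$ and $X_{Z,n+1}=\varphi\circ\theta^n(X_{Z,n})$; $\Phi^n_\omega(x)=\varphi_{\theta^{-1}\omega}\circ\cdots\circ\varphi_{\theta^{-n}\omega}(x)$, and $\Phi_\omega^n(B)=\{\Phi^n_\omega(x):x\in B\}$ for $B\subset E$. (H1): there is a random variable $\psi$ with values in the measurable maps $E\to E$ such that for all $x\in E$, $0_E\preceq\varphi(x)\preceq\psi(x)$ a.s.; $\psi$ is a.s. $\preceq$-non-decreasing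 and continuous; and $Y\circ\theta=\psi(Y)$ admits at least one $E$-valued solution. (H3): $\varphi$ admits a.s. a finite number of discontinuities, and there exists a locally finite subset $L\subset E$ with $0_E\in L$ that is a.s. stable by $\varphi$. The sequence $\{X_{Z,n}\}$ converges with strong backwards coupling to $X$ (a solution of $X\circ\theta=\varphi(X)$) if there is an a.s. finite random integer $N'$ such that $X_{Z,n}\circ\theta^{-n}=X$ for all $n\ge N'$. A stationary extension of $(\Omega,\mathcal F,\mathbf P,\theta)$ is a probability space with a flow leaving its probability invariant, projected onto $(\Omega,\mathcal F,\mathbf P,\theta)$, here by $(\omega,x)\mapsto\omega$. In the extension above, $\tilde{\mathcal F}$ is the trace of $\mathcal F\otimes\mathcal E$ on $\tilde\Omega$ and $\tilde{\mathbf P}[\{(\omega,x):\omega\in\mathcal A,x\in\mathcal B'\cap H_\omega\}]=\frac1c\int_{\mathcal A}\mathrm{Card}(H_\omega\cap\mathcal B')\,d\mathbf P(\omega)$ for $\mathcal A\in\mathcal F$, $\mathcal B'\in\mathcal E$, where $c$ is the (deterministic) a.s. value of $\mathrm{Card}\,H$.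
   Formalization: 0_E is least; F and the collection in (v) are nonempty; (H1) domination holds off one null set; (ii) the limit of Φ^n(0_E), if any, lies in E; (iii) uniqueness is among X⪯Y or coupling limits; (iv) sets {x⪯y} are relatively compact; (v) Card B=1 with positive probability on the event. *)

(* Defs.v *)
From HB Require Import structures.
From mathcomp Require Import all_boot all_order all_algebra.
From mathcomp Require Import all_classical all_reals all_analysis.
From mathcomp Require Import measurable_realfun.

Set Implicit Arguments.
Unset Strict Implicit.
Unset Printing Implicit Defensive.

Import Order.TTheory GRing.Theory Num.Theory.
Import numFieldNormedType.Exports.

Local Open Scope classical_set_scope.
Local Open Scope ring_scope.

Notation borel E := (g_sigma_algebraType (@open E)).

(** * The state space *)

(* The complete metric is part of the structure [completePseudoMetricType]; the
   Hausdorff property makes the pseudometric a metric, and for metric spaces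
   second countability is separability. *)
Definition polish (R : realType) (E : completePseudoMetricType R) : Prop :=
  hausdorff_space E /\ second_countable (T := E).

(* W is a Hausdorff space in which E sits as a dense topological subspace; it
   gives a meaning to limits "in the adherence of E" (W := E is allowed). *)
Definition dense_embedding (E W : topologicalType) (iota : E -> W) : Prop :=
  [/\ hausdorff_space W,
      injective iota,
      (forall U : set E,
         open U <-> exists2 V : set W, open V & U = iota @^-1` V)
    & closure (range iota) = setT].

Definition partial_order (T : Type) (le : rel T) : Prop :=
  [/\ reflexive le, antisymmetric le & transitive le].

Definition increasing_converge (E : Type) (W : topologicalType) (iota : E -> W)
    (le : rel E) : Prop :=
  forall u : nat -> E, (forall n, le (u n) (u n.+1)) ->
    exists y : W, (iota \o u) @ \oo --> y.

Definition nondecreasing_map (E : Type) (le : rel E) (f : E -> E) : Prop :=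
  forall x y, le x y -> le (f x) (f y).

Definition locally_finite (E : topologicalType) (L : set E) : Prop :=
  forall C : set E, compact C -> finite_set (L `&` C).

(** * Stationary ergodic dynamical systems and their extensions *)

Section dynamics.
Context {R : realType}.

(* [thetaV] is the inverse of [theta]. *)
Definition dynamical_system d (T : measurableType d) (P : probability T R)
    (theta thetaV : T -> T) : Prop :=
  [/\ cancel theta thetaV, cancel thetaV theta,
      measurable_fun setT theta, measurable_fun setT thetaV
    & forall A, measurable A -> P (theta @^-1` A) = P A].

Definition ergodic d (T : measurableType d) (P : probability T R)
    (theta : T -> T) : Prop :=
  forall A, measurable A -> theta @^-1` A = A -> P A = 0%E \/ P A = 1%E.

(* (T', P', theta') is a stationary extension of (T, P, theta) via [proj]. *)
Definition stationary_extension d (T : measurableType d) (P : probability T R)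
    (theta : T -> T) d' (T' : measurableType d') (P' : probability T' R)
    (theta' : T' -> T') (proj : T' -> T) : Prop :=
  [/\ exists thetaV', dynamical_system P' theta' thetaV',
      measurable_fun setT proj,
      (forall A, measurable A -> P' (proj @^-1` A) = P A)
    & forall z, proj (theta' z) = theta (proj z)].

End dynamics.

(** * Random maps and random sets *)

Section random_objects.
Context {R : realType} {E : completePseudoMetricType R}.
Context {d : measure_display} {T : measurableType d}.

(* Random elements of the set of measurable self-maps of E: joint measurability
   in (w, x). *)
Definition random_map (phi : T -> E -> E) : Prop :=
  measurable_fun setT (fun p : T * borel E => phi p.1 p.2 : borel E).

Definition random_var (Z : T -> E) : Prop :=
  measurable_fun setT (Z : T -> borel E).

Definition random_set (G : T -> set E) : Prop :=
  measurable [set p : T * borel E | G p.1 p.2].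

(* The cardinality of G w `&` A, in the extended reals, is a random variable for
   every Borel set A. *)
Definition measurable_card (G : T -> set E) : Prop :=
  forall A : set (borel E), measurable A ->
    measurable_fun setT
      ((fun w => counting (G w `&` A : set E)) : T -> \bar R).

Definition finite_random_set (B : T -> set E) : Prop :=
  (forall w, finite_set (B w)) /\ measurable_card B.

End random_objects.

(** * The recursion *)

Section recursion.
Context {E T : Type}.
Variables (theta thetaV : T -> T) (phi : T -> E -> E).

Fixpoint forward (Z : T -> E) (n : nat) (w : T) : E :=
  if n is m.+1 then phi (iter m theta w) (forward Z m w) else Z w.

(* backward n w = phi (thetaV w) \o ... \o phi (thetaV^n w) *)
Fixpoint backward (n : nat) (w : T) (x : E) : E :=
  if n is m.+1 then backward m w (phi (iter n thetaV w) x) else x.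

Definition backward_limit_set (G : T -> set E) (w : T) : set E :=
  \bigcap_(n in [set n | (1 <= n)%N]) (backward n w @` G (iter n thetaV w)).

End recursion.

Section solutions.
Context {R : realType} {E : completePseudoMetricType R}.
Context {d : measure_display} {T : measurableType d}.
Variables (P : probability T R) (theta thetaV : T -> T).

Definition solution (phi : T -> E -> E) (X : T -> E) : Prop :=
  random_var X /\ {ae P, forall w, X (theta w) = phi w (X w)}.

(* X_{Z,n} \o theta^-n = X for all n >= N', with N' a finite random integer. *)
Definition strong_backwards_coupling (phi : T -> E -> E) (Z X : T -> E) : Prop :=
  exists N' : T -> nat, measurable_fun setT N' /\
    {ae P, forall w, forall n, (N' w <= n)%N ->
       forward theta phi Z n (iter n thetaV w) = X w}.

Definition as_stable (phi : T -> E -> E) (S : set E) : Prop :=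
  {ae P, forall w, phi w @` S `<=` S}.

(* psi is a random map as in (H1), up to the existence of a solution of
   Y \o theta = psi(Y).  The domination holds for all x at once outside a single
   null set, as is needed to use it at random points x. *)
Definition dominating (le : rel E) (zero : E) (phi psi : T -> E -> E) : Prop :=
  [/\ random_map psi,
      {ae P, forall w, forall x, le zero (phi w x) /\ le (phi w x) (psi w x)},
      {ae P, forall w, nondecreasing_map le (psi w)}
    & {ae P, forall w, continuous (psi w)}].

Definition H1 (le : rel E) (zero : E) (phi : T -> E -> E) : Prop :=
  exists psi : T -> E -> E, dominating le zero phi psi /\
    exists Y : T -> E, solution psi Y.

Definition H3 (zero : E) (phi : T -> E -> E) : Prop :=
  {ae P, forall w, finite_set [set x | ~ {for x, continuous (phi w)}]} /\
  exists L : set E, [/\ locally_finite L, L zero & as_stable phi L].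

(* If the sequence backward n w zero has a limit in the adherence W of E, then
   this limit is a point of E.  Automatic when W := E; false for instance for
   phi w x = x + 1 on [0, +oo[, whose limit is the added point +oo. *)
Definition loynes_limit_proper (W : topologicalType) (iota : E -> W) (zero : E)
    (phi : T -> E -> E) : Prop :=
  {ae P, forall w, forall y : W,
     (fun n => iota (backward thetaV phi n w zero)) @ \oo --> y ->
     range iota y}.

End solutions.

(** * The extension carried by a random set *)

Section extension.
Context {R : realType} {E : completePseudoMetricType R}.
Context {d : measure_display} {T : measurableType d}.
Variable H : T -> set E.

Definition graph_type : Type := {p : T * borel E | H p.1 p.2}.

(* Measurable types are pointed, hence the point [z0], which plays no other
   role. *)
Definition pointed_graph of graph_type : Type := graph_type.

Variable z0 : graph_type.

HB.instance Definition _ := gen_eqMixin (pointed_graph z0).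
HB.instance Definition _ := gen_choiceMixin (pointed_graph z0).
HB.instance Definition _ := isPointed.Build (pointed_graph z0) z0.

Definition graph_val (z : pointed_graph z0) : T * borel E := sval z.

(* {(w, x) | x \in H w} with the trace of the product sigma-algebra. *)
Definition graph_space := g_sigma_algebra_preimageType graph_val.

HB.instance Definition _ := Measurable.on graph_space.

Definition graph_base (z : graph_space) : T := (graph_val z).1.
Definition graph_point (z : graph_space) : E := (graph_val z).2.

End extension.

Section conclusion.
Context {R : realType} {E : completePseudoMetricType R}.
Context {d : measure_display} {T : measurableType d}.
Variables (P : probability T R) (theta thetaV : T -> T) (phi : T -> E -> E).

Definition extension_on (H : T -> set E) : Prop :=
  exists (c : nat) (z0 : graph_type H) (Pt : probability (graph_space z0) R)
         (thetat : graph_space z0 -> graph_space z0),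
    [/\ (0 < c)%N /\ {ae P, forall w, (H w #= `I_c)%card},
        (forall (A : set T) (B : set (borel E)), measurable A -> measurable B ->
           Pt [set z | A (graph_base z) /\ B (graph_point z)] =
           ((c%:R^-1)%:E * \int[P]_(w in A) counting (H w `&` B : set E))%E),
        (forall z, graph_base (thetat z) = theta (graph_base z) /\
                   graph_point (thetat z) = phi (graph_base z) (graph_point z)),
        stationary_extension P theta Pt thetat (@graph_base R E d T H z0)
      & {ae Pt, forall z,
           graph_point (thetat z) = phi (graph_base z) (graph_point z)}].

Definition weak_solvability : Prop :=
  exists G : T -> set E,
    let H := backward_limit_set thetaV phi G in
    let finite_nonempty := [set w | finite_set (H w) /\ H w !=set0] in
    [/\ random_set G,
        {ae P, forall w, phi w @` G w `<=` G (theta w)},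
        measurable_card H,
        measurable finite_nonempty /\ (0 < P finite_nonempty)%E
      & extension_on H].

End conclusion.

(* Main.v *)
Require Import Defs.
From HB Require Import structures.
From mathcomp Require Import all_boot all_order all_algebra.
From mathcomp Require Import all_classical all_reals all_analysis.
From mathcomp Require Import measurable_realfun.

Set Implicit Arguments.
Unset Strict Implicit.
Unset Printing Implicit Defensive.

Import Order.TTheory GRing.Theory Num.Theory.
Import numFieldNormedType.Exports.

Local Open Scope classical_set_scope.
Local Open Scope ring_scope.

(** All five cases rest on the backward scheme: start the recursion from a random
    variable [Z] at time [-n] and observe it at time [0]. The resulting variables
    [V n] satisfy [V n.+1 (theta w) = phi w (V n w)]. The key fact
    ([weak_solvability_finite_range]) is that weak solvability holds as soon as
    the sequence [V n w] takes almost surely finitely many values.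

    Indeed, let [L w] be the set of values that [V n w] takes for infinitely many
    [n]. It is finite and nonempty, and the pigeonhole principle gives
    [phi w @` L w = L (theta w)]. Hence the cardinality of [L] cannot increase
    along the orbits; by ergodicity it is a constant [c], and [phi w] is a
    bijection from [L w] to [L (theta w)]. All these properties hold on a set of
    probability one that is exactly invariant under [theta]. Let [G] be [L] on
    that set and empty outside of it. Then [phi w @` G w = G (theta w)] for every
    [w], so [G] is its own backward limit set, and [(w, x) |-> (theta w, phi w x)]
    is a bijection of the graph of [G].

    Listing the points of [G w] by their first occurrence in [V n w] presents the
    random set [G] by countably many measurable sections. This makes its
    cardinalities measurable, and summing the images of [P] under the sections,
    divided by [c], gives the probability of the extension: it integrates the
    counting measures of the fibres of the graph. It is invariant because [phi w]
    carries the counting measure of [G w] to that of [G (theta w)]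
    ([carried_extension]).

    It remains to find [Z] with a finite range of values. For a stable finite set,
    [Z] is one of its points. For a continuous monotone [phi], [Z] is the solution
    given by Loynes' increasing limit, for which [V n] does not depend on [n]
    almost surely. Under domination and a locally finite stable set [L], [Z] is
    the least point: the scheme lies in [L] and below [Y], thus in a compact set.
    For renovating events, almost every orbit has visited the event in the past
    (Poincare recurrence), say at time [-n], and from then on the scheme is the
    image of a finite set by the map from time [-n] to time [0]. If the finite
    set is a singleton, all the schemes coincide after this visit, which gives the
    solution and the strong backwards coupling ([renovation_coupling]). The case
    where [Y] meets the least point is of that kind: the event is
    [Y w = zero], where every scheme below [Y] equals [zero]. *)

(** * Orbits of a stationary ergodic system *)

Section dynamics.
Context {R : realType} {d : measure_display} {T : measurableType d}.
Context (P : probability T R) (theta thetaV : T -> T).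
Context (dyn : dynamical_system P theta thetaV).

Lemma iterK n : cancel (iter n theta) (iter n thetaV).
Proof.
case: dyn => thetaK _ _ _ _.
by elim: n => // n IHn w; rewrite iterSr /= thetaK IHn.
Qed.

Lemma iterVS n w : iter n.+1 thetaV (theta w) = iter n thetaV w.
Proof. by case: dyn => thetaK _ _ _ _; rewrite iterSr thetaK. Qed.

Lemma measurable_iter (f : T -> T) n :
  measurable_fun setT f -> measurable_fun setT (iter n f).
Proof.
move=> mf; elim: n => [|n IHn]; first exact: measurable_id.
exact: measurableT_comp mf IHn.
Qed.

Lemma measurable_preimage d' (T' : measurableType d') (f : T -> T') A :
  measurable_fun setT f -> measurable A -> measurable (f @^-1` A).
Proof. by move=> mf mA; rewrite -[X in measurable X]setTI; exact: mf. Qed.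

Lemma measure_preimage_iter n A : measurable A ->
  P (iter n theta @^-1` A) = P A.
Proof.
case: dyn => _ _ mth _ inv; elim: n A => // n IHn A mA.
rewrite -(IHn A mA) -(inv (iter n theta @^-1` A)).
  by congr (P _); apply/seteqP; split=> w; rewrite /preimage /= -iterS iterSr.
by apply: measurable_preimage => //; exact: measurable_iter.
Qed.

Lemma measure_preimage_iterV n A : measurable A ->
  P (iter n thetaV @^-1` A) = P A.
Proof.
case: (dyn) => _ _ _ mthV _ mA.
rewrite -(measure_preimage_iter n); last first.
  by apply: measurable_preimage => //; exact: measurable_iter.
by congr (P _); apply/seteqP; split=> w; rewrite /preimage /= iterK.
Qed.

Lemma ae_measure1 A : measurable A -> P A = 1%E -> {ae P, forall w, A w}.
Proof.
move=> mA A1; apply/negligibleP; first exact: measurableC.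
by rewrite [LHS]probability_setC // A1 subee.
Qed.

(** The union of the increasing sets [iter k theta @^-1` A] is strictly
    invariant and has the probability of [A]. *)
Lemma zero_one_subinvariant (erg : ergodic P theta) A :
  measurable A -> A `<=` theta @^-1` A -> P A = 0%E \/ P A = 1%E.
Proof.
move=> mA subA; have [_ _ mth _ _] := dyn.
pose B k := iter k theta @^-1` A.
have mB k : measurable (B k).
  by apply: measurable_preimage => //; exact: measurable_iter.
have mU : measurable (\bigcup_k B k) by exact: bigcupT_measurable.
have BS k : B k `<=` B k.+1 by move=> w /subA.
have ndB : nondecreasing_seq B.
  by apply/nondecreasing_seqP => k; exact/subsetPset.
have PU : P (\bigcup_k B k) = P A.
  have /cvg_lim <- // := nondecreasing_cvg_mu (mu := P) mB mU ndB.
  rewrite (_ : P \o B = fun=> P A) ?lim_cst//.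
  by apply/funext => k /=; rewrite /B measure_preimage_iter.
rewrite -PU; apply: erg => //; apply/seteqP; split => w [k _ Bkw].
  by exists k.+1 => //; rewrite /B /preimage /= -iterS iterSr.
exists k => //; rewrite /preimage/=; have := BS _ _ Bkw.
by rewrite /B /preimage/= -iterS iterSr.
Qed.

(** The set of points having visited [A] in the past is mapped into itself by
    [theta], so the zero-one law applies to it. *)
Lemma ae_backward_visit (erg : ergodic P theta) A :
  measurable A -> (0 < P A)%E ->
  {ae P, forall w, exists n, A (iter n thetaV w)}.
Proof.
move=> mA A0; have [_ _ _ mthV _] := dyn.
pose B k := iter k thetaV @^-1` A.
have mB k : measurable (B k).
  by apply: measurable_preimage => //; exact: measurable_iter.
have mU : measurable (\bigcup_k B k) by exact: bigcupT_measurable.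
have subU : \bigcup_k B k `<=` theta @^-1` (\bigcup_k B k).
  by move=> w [k _ Bk]; exists k.+1; rewrite // /B /preimage /mkset iterVS.
have [U0|U1] := zero_one_subinvariant erg mU subU.
  suff : (P A <= 0)%E by rewrite leNgt A0.
  rewrite -U0; apply: le_measure; rewrite ?inE //.
  by move=> w Aw; exists 0%N.
apply: filterS (ae_measure1 mU U1) => w [k _ Bk]; by exists k.
Qed.

(** Keeping the points whose whole orbit, past and future, avoids a null set turns
    an almost sure property into a sure one, on a strictly invariant set. *)
Lemma ae_invariant_core (Q : T -> Prop) : {ae P, forall w, Q w} ->
  exists O : set T, [/\ measurable O, P O = 1%E,
    (forall w, O w <-> O (theta w)) & O `<=` Q].
Proof.
have [thetaK thetaVK mth mthV _] := dyn.
move=> [N [mN N0 subN]].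
pose O := (\bigcap_n iter n theta @^-1` (~` N)) `&`
          (\bigcap_n iter n thetaV @^-1` (~` N)).
have mF n : measurable (iter n theta @^-1` (~` N)).
  by apply: measurable_preimage; [exact: measurable_iter|exact: measurableC].
have mV n : measurable (iter n thetaV @^-1` (~` N)).
  by apply: measurable_preimage; [exact: measurable_iter|exact: measurableC].
have mO : measurable O.
  by apply: measurableI; apply: bigcap_measurable => //; exists 0%N.
have PN : P (~` N) = 1%E by rewrite probability_setC // N0 sube0.
exists O; split => //.
- suff NO : P (~` O) = 0%E.
    by rewrite -(setCK O) probability_setC ?NO ?sube0 //; exact: measurableC.
  apply/negligibleP; first exact: measurableC.
  rewrite setCI !setC_bigcap; apply: negligibleU; apply: negligible_bigcup => n.
  + apply/negligibleP; first exact/measurableC/mF.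
    by rewrite preimage_setC setCK; exact: etrans (measure_preimage_iter n mN) N0.
  + apply/negligibleP; first exact/measurableC/mV.
    by rewrite preimage_setC setCK; exact: etrans (measure_preimage_iterV n mN) N0.
- move=> w; split=> -[Of Ob]; split => n _.
  + by have := Of n.+1 I; rewrite /preimage /mkset iterSr.
  + case: n => [|n]; first exact: (Of 1%N).
    by rewrite /preimage /mkset iterVS; exact: Ob.
  + case: n => [|n]; last by rewrite /preimage /mkset iterSr; exact: Of.
    by have := Ob 1%N I; rewrite /preimage /mkset /= thetaK.
  + by have := Ob n.+1 I; rewrite /preimage /mkset iterVS.
- move=> w [/(_ 0%N I) Ow _]; apply: contrapT => /subN; exact: Ow.
Qed.

End dynamics.

(** * Borel maps into a Polish space *)

Section borel_maps.
Context {R : realType} {E : completePseudoMetricType R} (E_polish : polish E).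
Context {d : measure_display} {T : measurableType d}.
Implicit Types f g : T -> borel E.

Lemma measurable_open (U : set E) : open U -> measurable (U : set (borel E)).
Proof. by move=> oU; exact: sub_sigma_algebra. Qed.

Lemma measurable_fun_open f :
  (forall U : set E, open U -> measurable (f @^-1` U)) -> measurable_fun setT f.
Proof.
move=> mf; apply: (@measurability _ _ T (borel E) setT f (@open E)) => //.
by move=> _ [U oU <-]; rewrite setTI; exact: mf.
Qed.

(** A countable family of open sets is indexed by [nat] through an injection; the
    union over the fibre of [n] has at most one member. *)
Lemma countable_base : exists U : nat -> set E, (forall n, open (U n)) /\
  forall x A, nbhs x A -> exists2 n, U n x & U n `<=` A.
Proof.
have [_ [B /countable_injP [f finj] [Bo Bb]]] := E_polish.
exists (fun n => \bigcup_(V in [set V | B V /\ f V = n]) V); split.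
  by move=> n; apply: bigcup_open => V [/Bo].
move=> x A /Bb [V [BV Vx] VA]; exists (f V); first by exists V.
move=> y [V' [BV' fV'] V'y]; apply: VA.
by rewrite -(finj V' V) // ?inE.
Qed.

(** Two distinct points are separated by two disjoint members of a countable
    base, so the set where two Borel maps differ is a countable union. *)
Lemma measurable_eq_borel f g :
  measurable_fun setT f -> measurable_fun setT g ->
  measurable [set w | f w = g w].
Proof.
move=> mf mg; have [U [Uo Ub]] := countable_base; have [hE _] := E_polish.
rewrite -[X in measurable X]setCK; apply: measurableC.
rewrite (_ : ~` _ = \bigcup_i \bigcup_(j in [set j | U i `&` U j = set0])
    (f @^-1` U i `&` g @^-1` U j)).
  apply: bigcupT_measurable => i; apply: bigcup_measurable => j _.
  by apply: measurableI; apply: measurable_preimage => //; exact: measurable_open.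
apply/seteqP; split => w /=.
  move=> fg; move: hE; rewrite open_hausdorff => sep.
  have /eqP/sep ne : (f w : E) <> g w by [].
  case: ne => -[A B] /= [/set_mem Af /set_mem Bg] [oA oB /eqP AB].
  have [i Ui UiA] := Ub _ _ (open_nbhs_nbhs (conj oA Af)).
  have [j Uj UjB] := Ub _ _ (open_nbhs_nbhs (conj oB Bg)).
  exists i => //; exists j => //; apply/seteqP; split=> // x [/UiA Ax /UjB Bx].
  by have : (A `&` B) x by []; rewrite AB.
move=> [i _ [j Uij [Ui Uj]]] fg.
have : (U i `&` U j) (f w) by split => //; rewrite fg.
by rewrite Uij.
Qed.

(** By regularity, [f w] lies in an open set [U] as soon as the sequence stays
    in a basic open set whose closure is contained in [U]. *)
Lemma measurable_fun_cvg_borel (V : nat -> T -> borel E) f :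
  (forall n, measurable_fun setT (V n)) ->
  (forall w, (fun n => V n w : E) @ \oo --> (f w : E)) ->
  measurable_fun setT f.
Proof.
move=> mV Vf; have [U [Uo Ub]] := countable_base.
apply: measurable_fun_open => A oA.
rewrite (_ : _ @^-1` _ = \bigcup_(i in [set i | closure (U i) `<=` A])
    \bigcup_m \bigcap_(n in [set n | (m <= n)%N]) (V n @^-1` U i)).
  apply: bigcup_measurable => i _; apply: bigcupT_measurable => m.
  apply: bigcap_measurable; first by exists m => /=.
  move=> n _; apply: measurable_preimage => //; exact: measurable_open.
apply/seteqP; split => w /=.
  move=> Afw; have nA : nbhs (f w : E) A by exact: open_nbhs_nbhs.
  have [B nB BA] := @uniform_regular E _ _ nA.
  have [i Ui UiB] := Ub _ _ nB.
  exists i; first exact: subset_trans (closureS UiB) BA.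
  have [m _ Um] := Vf w _ (open_nbhs_nbhs (conj (Uo i) Ui)).
  by exists m.
move=> [i UiA [m _ Um]]; apply: UiA.
apply: (@closed_cvg _ _ _ _ _ _ (@closed_closure _ (U i)) _ _ (Vf w)).
by exists m => // n mn; apply: subset_closure; exact: Um.
Qed.

End borel_maps.

(** * Random sets enumerated by a sequence of random variables *)

Section counting.
Context {R : realType} {U : choiceType}.

Lemma counting_card_eq {U' : choiceType} (A : set U) (B : set U') :
  (A #= B)%card -> counting A = counting B :> \bar R.
Proof.
move=> AB; have finAB : finite_set A = finite_set B.
  by rewrite (eq_finite_set AB).
rewrite /counting finAB; case: ifPn => // /asboolP finB.
by have /fcard_eq -> : (A #= B)%card by []; rewrite // finAB.
Qed.

Lemma counting_ge0 (A : set U) : (0 <= counting A :> \bar R)%E.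
Proof. by rewrite /counting; case: ifPn; rewrite ?lee_fin // lee_pinfty. Qed.

Lemma counting_card_II (A : set U) n :
  (A #= `I_n)%card -> counting A = n%:R%:E :> \bar R.
Proof.
move=> An; have finA : finite_set A by apply/finite_setP; exists n.
by rewrite /counting asboolT // (card_fset_set An).
Qed.

Lemma counting_le_II (A : set U) n :
  (counting A <= n%:R%:E :> \bar R)%E = (A #<= `I_n)%card.
Proof.
have [finA|infA] := pselect (finite_set A).
  have /finite_setP [m Am] := finA.
  by rewrite (counting_card_II Am) lee_fin ler_nat (card_le_eql Am) card_le_II.
rewrite /counting asboolF // leye_eq; symmetry; apply/negP => An.
by apply: infA; apply/finite_set_leP; exists n.
Qed.

Definition first_occurrence (v : nat -> U) (n : nat) : Prop :=
  forall j, (j < n)%N -> v j <> v n.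

Lemma ex_first_occurrence (v : nat -> U) n :
  exists2 m, first_occurrence v m & v m = v n.
Proof.
have ex : exists m, v m == v n by exists n.
exists (ex_minn ex); case: ex_minnP => m /eqP vm mmin //.
by move=> j jm vj; have := mmin j; rewrite vj vm eqxx leqNgt jm => /(_ isT).
Qed.

Lemma first_occurrence_inj (v : nat -> U) m n :
  first_occurrence v m -> first_occurrence v n -> v m = v n -> m = n.
Proof.
move=> fm fn vmn; case: (ltngtP m n) => // [mn|nm].
  by case: (fn _ mn).
by case: (fm _ nm).
Qed.

(** Each element of [A] is counted at its first occurrence in the sequence. *)
Lemma counting_first_occurrence (v : nat -> U) (A : set U) : A `<=` range v ->
  counting A =
  (\sum_(n <oo) \d_ n [set m | first_occurrence v m /\ A (v m)])%E :> \bar R.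
Proof.
move=> Av; rewrite -counting_dirac; apply: counting_card_eq.
set N := [set m | _]; have -> : A = v @` N.
  apply/seteqP; split => [x Ax|_ [m [_ Am] <-] //].
  have [n _ vn] := Av _ Ax; have [m fm vm] := ex_first_occurrence v n.
  by exists m; rewrite /N /= ?vm ?vn.
apply: inj_card_eq => m n /set_mem [fm _] /set_mem [fn _].
exact: first_occurrence_inj.
Qed.

End counting.

Section enumerated_random_set.
Context {R : realType} {E : completePseudoMetricType R} (E_polish : polish E).
Context {d : measure_display} {T : measurableType d}.
Context (V : nat -> T -> E) (mV : forall n, random_var (V n)).
Context (G : T -> set E) (GV : forall w, G w `<=` range (V ^~ w)).
Context (mG : forall n, measurable [set w | G w (V n w)]).

(** For a given [w], the indices [n] with [w] in this set are in bijection with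
    the points of [G w], through [V n w]. *)
Definition enumeration_domain (n : nat) : set T :=
  [set w | first_occurrence (V ^~ w) n /\ G w (V n w)].

Lemma measurable_enumeration_domain n : measurable (enumeration_domain n).
Proof.
apply: measurableI; last exact: mG.
rewrite [X in measurable X](_ : _ = \bigcap_(j in [set j | (j < n)%N])
   ~` [set w | V j w = V n w]);
  last by apply/seteqP; split=> w fw j /fw.
apply: bigcap_measurableType => j _; apply: measurableC.
exact: (measurable_eq_borel E_polish (mV j) (mV n)).
Qed.

Lemma measurable_graph_var (Z : T -> E) (S : set (T * borel E)) :
  random_var Z -> measurable S -> measurable [set w | S (w, Z w)].
Proof.
move=> mZ mS; have mf : measurable_fun setT (fun w => (w, Z w : borel E)).
  by apply/measurable_fun_pairP; split; [exact: measurable_id|exact: mZ].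
exact: measurable_preimage mf mS.
Qed.

Lemma random_set_enumerated : random_set G.
Proof.
rewrite /random_set [X in measurable X](_ : _ = \bigcup_n
    ([set p : T * borel E | V n p.1 = p.2] `&` fst @^-1` [set w | G w (V n w)])).
  apply: bigcupT_measurable => n; apply: measurableI.
    apply: (measurable_eq_borel E_polish); last exact: measurable_snd.
    by apply: measurableT_comp; [exact: mV|exact: measurable_fst].
  apply: measurable_preimage; [exact: measurable_fst|exact: mG].
apply/seteqP; split => -[w x] /=.
  by move=> Gx; have [n _ Vn] := GV Gx; exists n => //=; rewrite Vn.
by move=> [n _ /= [<-]].
Qed.

(** Sections of arbitrary product sets, not only of rectangles, are counted: the
    invariance of the extension needs sets that depend on [w]. *)
Lemma counting_section (S : set (T * borel E)) w :
  counting (G w `&` [set x | S (w, x)]) =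
  (\sum_(n <oo)
    (\1_(enumeration_domain n `&` [set u | S (u, V n u)]) w)%:E)%E :> \bar R.
Proof.
rewrite (@counting_first_occurrence _ _ (V ^~ w)); last first.
  by move=> x [/GV].
apply: eq_eseriesr => n _; rewrite /dirac !indicE; congr (_%:R%:E).
congr nat_of_bool; apply/idP/idP => /set_mem.
  by move=> [? [? ?]]; apply/mem_set; split=> //; split.
by move=> [[? ?] ?]; apply/mem_set; split=> //; split.
Qed.

Let mS (S : set (T * borel E)) n : measurable S ->
  measurable (enumeration_domain n `&` [set u | S (u, V n u)]).
Proof.
move=> mS; apply: measurableI; first exact: measurable_enumeration_domain.
exact: measurable_graph_var.
Qed.

Lemma measurable_counting_section (S : set (T * borel E)) : measurable S ->
  measurable_fun setT
    ((fun w => counting (G w `&` [set x | S (w, x)] : set E)) : T -> \bar R).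
Proof.
move=> mS'; under eq_fun do rewrite counting_section.
apply: (@ge0_emeasurable_sum _ _ _ setT
  (fun n w => (\1_(enumeration_domain n `&` [set u | S (u, V n u)]) w)%:E)
  xpredT).
  by move=> n w _ _; rewrite lee_fin.
by move=> n _; apply/measurable_EFinP; apply: measurable_indic; exact: mS.
Qed.

Lemma integral_counting_section (P : probability T R) (S : set (T * borel E)) A :
  measurable S -> measurable A ->
  (\int[P]_(w in A) counting (G w `&` [set x | S (w, x)] : set E) =
  \sum_(n <oo) P (enumeration_domain n `&` [set u | S (u, V n u)] `&` A))%E.
Proof.
move=> mS' mA; under eq_integral do rewrite counting_section.
rewrite integral_nneseries //; last first.
  by move=> n; apply/measurable_EFinP; apply: measurable_indic; exact: mS.
by apply: eq_eseriesr => n _; rewrite integral_indic //; exact: mS.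
Qed.

Lemma measurable_card_enumerated : measurable_card G.
Proof.
move=> A mA; apply: (@measurable_counting_section (snd @^-1` A)).
exact: measurable_preimage measurable_snd mA.
Qed.

End enumerated_random_set.

(** * The extension carried by a random set *)

Section measure_probability.
Context {R : realType} {d : measure_display} {T : measurableType d}.
Context (mu : {measure set T -> \bar R}) (mu1 : mu setT = 1%E).

(** The proof is an argument so that the probability structure can be attached to
    this function. *)
Definition measure_probability_fun of mu setT = 1%E : set T -> \bar R := mu.

HB.instance Definition _ := Measure.copy (measure_probability_fun mu1) mu.
HB.instance Definition _ :=
  Measure_isProbability.Build d T R (measure_probability_fun mu1) mu1.

Definition measure_probability : probability T R := measure_probability_fun mu1.

End measure_probability.

Section carried_extension.
Context {R : realType} {E : completePseudoMetricType R} (E_polish : polish E).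
Context {d : measure_display} {T : measurableType d}.
Context (P : probability T R) (theta thetaV : T -> T).
Context (dyn : dynamical_system P theta thetaV).
Context (phi : T -> E -> E) (phi_meas : random_map phi).
Context (V : nat -> T -> E) (mV : forall n, random_var (V n)).
Context (G : T -> set E) (GV : forall w, G w `<=` range (V ^~ w)).
Context (mG : forall n, measurable [set w | G w (V n w)]).
Context (phiG : forall w, phi w @` G w = G (theta w)).
Context (phi_inj : forall w, {in G w &, injective (phi w)}).
Context (c : nat) (c_gt0 : (0 < c)%N).
Context (Gc : {ae P, forall w, (G w #= `I_c)%card}).
Context (z0 : graph_type G).

Local Notation graph := (graph_space z0).
Local Notation gval := (@graph_val R E d T G z0).
Local Notation D := (enumeration_domain V G).

Let mD n : measurable (D n).
Proof. exact: measurable_enumeration_domain. Qed.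

Let graphP (z : graph) : G (gval z).1 (gval z).2.
Proof. exact: svalP z. Qed.

Let graph_val_inj : injective gval.
Proof.
move=> [p Gp] [q Gq]; rewrite /graph_val /= => pq.
by case: _ / pq in Gq *; rewrite (Prop_irrelevance Gp Gq).
Qed.

Lemma measurable_graph_val : measurable_fun setT (gval : graph -> T * borel E).
Proof. by move=> _ S mS; exists S. Qed.

Lemma measurable_fun_graph d' (T' : measurableType d') (f : T' -> graph) :
  measurable_fun setT ((fun t => gval (f t)) : T' -> T * borel E) ->
  measurable_fun setT f.
Proof.
move=> mf _ _ [S mS <-]; rewrite setTI [X in measurable X](_ : _ =
  (fun t => gval (f t)) @^-1` S); first exact: measurable_preimage mf mS.
by apply/seteqP; split=> t /=; [case|split].
Qed.

(** The point [z0] is a default value outside of the domain of the section. *)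
Definition graph_section (n : nat) (w : T) : graph :=
  match pselect (G w (V n w)) with
  | left Gw => exist (fun p : T * borel E => G p.1 p.2) (w, V n w) Gw
  | right _ => z0
  end.

Lemma graph_val_section n w : G w (V n w) ->
  gval (graph_section n w) = (w, V n w).
Proof. by rewrite /graph_section; case: pselect. Qed.

Lemma measurable_graph_section n : measurable_fun setT (graph_section n).
Proof.
apply: measurable_fun_graph => _ S mS; rewrite setTI.
rewrite [X in measurable X](_ : _ =
  ([set w | G w (V n w)] `&` [set w | S (w, V n w)]) `|`
  (~` [set w | G w (V n w)] `&` [set w | S (sval z0)])).
  apply: measurableU; apply: measurableI => //.
  - exact: (measurable_graph_var (mV n)).
  - exact: measurableC.
  - by have [Sz|Sz] := pselect (S (sval z0));
      [rewrite (_ : mkset _ = setT)|rewrite (_ : mkset _ = set0)] => //;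
      apply/seteqP; split.
apply/seteqP; split=> w; rewrite /preimage /= /graph_section /graph_val.
  by case: pselect => Gw /= Sw; [left|right].
by case: pselect => Gw /= [] [].
Qed.

(** Summing over [n] the image of [P], restricted to the domain [D n], under the
    [n]-th partial section of the graph gives each fibre its counting measure. *)
Lemma ex_graph_measure : exists mu : {measure set graph -> \bar R},
  forall S, measurable S -> mu (gval @^-1` S) =
    ((c%:R^-1)%:E * \int[P]_w counting (G w `&` [set x | S (w, x)] : set E))%E.
Proof.
have [m mE] : {m : nat -> {measure set graph -> \bar R} |
    forall n A, m n A = P (graph_section n @^-1` A `&` D n)}.
  unshelve eexists (fun n => pushforward (mrestr P (mD n)) (graph_section n)).
    exact: measurable_graph_section.
  by [].
have c0 : 0 <= c%:R^-1 :> R by rewrite invr_ge0.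
exists (mscale (NngNum c0) (mseries m 0)) => S mS.
rewrite /= /mscale /= /mseries (integral_counting_section E_polish mV GV mG) //.
congr (_ * _)%E; apply: eq_eseriesr => n _; rewrite mE setIT; congr (P _).
apply/seteqP; split=> w; rewrite /preimage /=.
  by move=> [+ Dw]; rewrite graph_val_section //; case: (Dw).
by move=> [Dw Sw]; split=> //; rewrite graph_val_section //; case: Dw.
Qed.

Lemma ex_graph_probability : exists Pt : probability graph R,
  forall S, measurable S -> Pt (gval @^-1` S) =
    ((c%:R^-1)%:E * \int[P]_w counting (G w `&` [set x | S (w, x)] : set E))%E.
Proof.
have [mu muE] := ex_graph_measure.
suff mu1 : mu setT = 1%E.
  by exists (measure_probability mu1).
rewrite -(preimage_setT gval) muE //.
rewrite (@ge0_ae_eq_integral _ _ _ _ _ _ (cst c%:R%:E)) //; last 4 first.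
- exact: (measurable_counting_section E_polish mV GV mG measurableT).
- by move=> w _; exact: counting_ge0.
- by move=> w _; rewrite lee_fin.
- by apply: filterS Gc => w Gw _; rewrite setIT (counting_card_II Gw).
rewrite integral_cst //= (@probability_setT _ _ _ P) mule1 -EFinM mulVf //.
by rewrite pnatr_eq0 -lt0n.
Qed.


Definition graph_step_proof (z : graph) :
  G (theta (gval z).1) (phi (gval z).1 (gval z).2).
Proof. by rewrite -phiG; exists (gval z).2. Qed.

Definition graph_step (z : graph) : graph :=
  exist (fun p : T * borel E => G p.1 p.2)
    (theta (gval z).1, phi (gval z).1 (gval z).2) (graph_step_proof z).

Lemma graph_step_val z :
  gval (graph_step z) = (theta (gval z).1, phi (gval z).1 (gval z).2).
Proof. by []. Qed.

Lemma measurable_graph_step : measurable_fun setT graph_step.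
Proof.
have [_ _ mth _ _] := dyn; apply: measurable_fun_graph.
apply: (measurableT_comp
  (f := (fun p : T * borel E => (theta p.1, phi p.1 p.2 : borel E))));
  last exact: measurable_graph_val.
apply/measurable_fun_pairP; split; last exact: phi_meas.
exact: measurableT_comp mth measurable_fst.
Qed.

(** Surjectivity of [phi w] from [G w] to [G (theta w)] gives a right inverse, and
    its injectivity on [G w] makes that inverse two-sided. *)
Lemma ex_graph_step_inverse :
  exists stepV : graph -> graph, cancel graph_step stepV /\ cancel stepV graph_step.
Proof.
have [thetaK thetaVK _ _ _] := dyn.
have pre (z : graph) : exists z' : graph, graph_step z' = z.
  have : G (theta (thetaV (gval z).1)) (gval z).2 by rewrite thetaVK.
  rewrite -phiG => -[x Gx phix].
  exists (exist (fun p : T * borel E => G p.1 p.2) (thetaV (gval z).1, x) Gx).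
  apply: graph_val_inj; rewrite graph_step_val /= thetaVK phix.
  by case: (gval z).
have [stepV stepVK] := choice pre; exists stepV; split=> // z.
have inj z1 z2 : graph_step z1 = graph_step z2 -> z1 = z2.
  move/(congr1 gval); rewrite !graph_step_val => -[/(can_inj thetaK) e1 e2].
  apply: graph_val_inj; case: (gval z1) (gval z2) (graphP z1) (graphP z2) e1 e2.
  move=> w1 x1 [w2 x2] /= G1 G2 e1; rewrite -e1 in G2 * => e2.
  by rewrite (phi_inj _ _ e2) ?inE.
exact/inj/stepVK.
Qed.

(** A point of the graph has its preimage among countably many candidates, the
    points [(theta^-1 w, V n (theta^-1 w))]. *)
Lemma measurable_graph_step_inverse (stepV : graph -> graph) :
  cancel graph_step stepV -> cancel stepV graph_step ->
  measurable_fun setT stepV.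
Proof.
move=> stepK stepVK; have [thetaK thetaVK _ mthV _] := dyn.
apply: measurable_fun_graph => _ S mS; rewrite setTI.
pose u n (p : T * borel E) : T * borel E := (thetaV p.1, V n (thetaV p.1)).
have mthV1 : measurable_fun setT (fun p : T * borel E => thetaV p.1).
  exact: measurableT_comp mthV measurable_fst.
have mu n : measurable_fun setT (u n).
  apply/measurable_fun_pairP; split; first exact: mthV1.
  exact: measurableT_comp (mV n) mthV1.
pose C n := ((fun p : T * borel E => thetaV p.1) @^-1` [set w | G w (V n w)])
  `&` ([set p | phi (u n p).1 (u n p).2 = p.2] `&` (u n @^-1` S)).
have mC n : measurable (C n).
  apply: measurableI; first exact: measurable_preimage mthV1 (mG n).
  apply: measurableI; last exact: measurable_preimage (mu n) mS.
  apply: (measurable_eq_borel E_polish); last exact: measurable_snd.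
  exact: measurableT_comp phi_meas (mu n).
exists (\bigcup_n C n); first exact: bigcupT_measurable.
rewrite setTI; apply/seteqP; split=> z.
  move=> [n _ [Gn [/= eqz Sn]]].
  suff -> : stepV z = exist (fun p : T * borel E => G p.1 p.2) (u n (gval z)) Gn.
    exact: Sn.
  rewrite -[LHS]/(stepV z) -(stepK (exist _ _ _)); congr (stepV _).
  apply: graph_val_inj; rewrite graph_step_val /= thetaVK eqz.
  by case: (gval z).
rewrite /preimage /= => Sz; have := graph_step_val (stepV z); rewrite stepVK.
have := graphP (stepV z); case: (gval (stepV z)) Sz => w x /= Swx Gwx zE.
have [n _ Vn] := GV Gwx; exists n => //.
by rewrite /C /preimage /u /= zE /= thetaK Vn.
Qed.

Lemma integral_preimage (f : T -> \bar R) : measurable_fun setT f ->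
  (forall w, 0 <= f w)%E -> (\int[P]_w f (theta w) = \int[P]_w f w)%E.
Proof.
have [_ _ mth _ inv] := dyn => mf f0.
have := @ge0_integral_pushforward _ _ _ _ R _ mth P setT f measurableT mf
  (fun w _ => f0 w).
rewrite preimage_setT => <-; apply: eq_measure_integral => A mA _; exact: inv.
Qed.

(** [phi w] maps [G w] bijectively to [G (theta w)], so it carries one counting
    measure to the other. *)
Lemma counting_graph_step (S : set (T * borel E)) w :
  counting (G w `&` [set x | S (theta w, phi w x)]) =
  counting (G (theta w) `&` [set x | S (theta w, x)]) :> \bar R.
Proof.
symmetry; apply: counting_card_eq.
rewrite [X in (X #= _)%card](_ : _ =
  phi w @` (G w `&` [set x | S (theta w, phi w x)])).
  apply: inj_card_eq => x y /set_mem [Gx _] /set_mem [Gy _].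
  by apply: phi_inj; rewrite inE.
rewrite -phiG; apply/seteqP; split=> y /=.
  by move=> [[x Gx <-] Sx]; exists x.
by move=> [x [Gx Sx] <-]; split=> //; exists x.
Qed.

Lemma carried_extension : extension_on P theta phi G.
Proof.
have [thetaK thetaVK mth mthV inv] := dyn.
have [Pt PtE] := ex_graph_probability.
have [stepV [stepK stepVK]] := ex_graph_step_inverse.
have PtX (A : set T) (B : set (borel E)) : measurable A -> measurable B ->
    Pt [set z | A (graph_base z) /\ B (graph_point z)] =
    ((c%:R^-1)%:E * \int[P]_(w in A) counting (G w `&` B : set E))%E.
  move=> mA mB; have mAB := measurableX mA mB.
  rewrite [LHS](PtE _ mAB); congr (_ * _)%E.
  rewrite (integral_counting_section E_polish mV GV mG) //.
  have mB' : measurable (snd @^-1` B : set (T * borel E)).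
    exact: measurable_preimage measurable_snd mB.
  have := integral_counting_section E_polish mV GV mG P mB' mA.
  rewrite /preimage /= => ->.
  apply: eq_eseriesr => n _; congr (P _); rewrite setIT.
  by apply/seteqP; split=> w /= [[? ?]]; [case|]; split.
exists c, z0, Pt, graph_step; split => //.
split.
- exists stepV; split=> //.
  + exact: measurable_graph_step.
  + exact: measurable_graph_step_inverse.
  + move=> _ [S mS <-]; rewrite setTI.
    have mstep := measurable_preimage measurable_graph_step
      (measurable_preimage measurable_graph_val mS).
    pose S' : set (T * borel E) := [set p | S (theta p.1, phi p.1 p.2)].
    have mS' : measurable S'.
      apply: (measurable_preimage
        (f := fun p : T * borel E => (theta p.1, phi p.1 p.2 : borel E))) mS.
      apply/measurable_fun_pairP; split; last exact: phi_meas.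
      exact: measurableT_comp mth measurable_fst.
    rewrite PtE // [LHS](PtE _ mS'); congr (_ * _)%E.
    rewrite -(@integral_preimage (fun w => counting (G w `&` [set x | S (w, x)]))).
    * by apply: eq_integral => w _; exact: counting_graph_step.
    * exact: (measurable_counting_section E_polish mV GV mG).
    * by move=> w; exact: counting_ge0.
- exact: measurableT_comp measurable_fst measurable_graph_val.
- move=> A mA; rewrite [X in Pt X](_ : _ =
    [set z | A (graph_base z) /\ [set: borel E] (graph_point z)]).
    rewrite PtX //; under eq_integral do rewrite setIT.
    have mcount := measurable_counting_section E_polish mV GV mG measurableT.
    rewrite (@ge0_ae_eq_integral _ _ _ _ _ _ (cst c%:R%:E)) //.
    + rewrite integral_cst // muleA -EFinM mulVf ?mul1e //.
      by rewrite pnatr_eq0 -lt0n.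
    + apply: measurable_funTS; apply: eq_measurable_fun mcount => w _.
      by rewrite /= setIT.
    + by move=> w _; exact: counting_ge0.
    + by move=> w _; rewrite lee_fin.
    + by apply: filterS Gc => w Gw _; exact: counting_card_II.
  by apply/seteqP; split=> z // [].
- by move=> z.
- by apply: aeW => z.
Qed.

End carried_extension.

(** * Values taken infinitely often *)

Section infinitely_often.
Context {U : choiceType}.
Implicit Type v : nat -> U.

Definition infinitely_often (S : nat -> Prop) : Prop :=
  forall n, exists2 m, (n <= m)%N & S m.

Lemma infinitely_often_pigeonhole v (A : set U) (S : nat -> Prop) :
  finite_set A -> infinitely_often (fun m => S m /\ A (v m)) ->
  exists x, infinitely_often (fun m => S m /\ v m = x).
Proof.
move=> /finite_seqP [s ->]; elim: s S => [|a s IHs] S Sio.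
  by have [m _ [_]] := Sio 0%N.
have [aio|/existsNP [n0 an0]] := pselect (infinitely_often (fun m => S m /\ v m = a)).
  by exists a.
apply: IHs => n; have [m nm [Sm]] := Sio (maxn n n0).
rewrite /= inE => /orP [/eqP vma|vms].
  by case: an0; exists m => //; apply: leq_trans nm; exact: leq_maxr.
by exists m => //; apply: leq_trans nm; exact: leq_maxl.
Qed.

Definition values_io v : set U := [set x | infinitely_often (fun m => v m = x)].

Lemma values_io_range v : values_io v `<=` range v.
Proof. by move=> x /(_ 0%N) [m _ <-]; exists m. Qed.

Lemma values_io_nonempty v : finite_set (range v) -> values_io v !=set0.
Proof.
move=> finv; have [|x xio] := infinitely_often_pigeonhole (v := v)
    (S := fun=> True) finv.
  by move=> n; exists n => //; split=> //; exists n.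
by exists x => n; have [m nm [_ vm]] := xio n; exists m.
Qed.

(** A value [y] taken infinitely often by [v'] comes from values of [v], and
    finiteness of the range makes one of these occur infinitely often. *)
Lemma image_values_io v v' (f : U -> U) : finite_set (range v) ->
  (forall n, v' n.+1 = f (v n)) -> f @` values_io v = values_io v'.
Proof.
move=> finv v'S; apply/seteqP; split => [_ [x xio <-] n|y yio].
  have [m nm vm] := xio n; exists m.+1; first exact: leqW.
  by rewrite v'S vm.
have [|x xio] := infinitely_often_pigeonhole (v := v)
    (S := fun m => v' m.+1 = y) finv.
  move=> n; have [[//|m] nm v'm] := yio n.+1.
  by exists m => //; split=> //; exists m.
exists x; first by move=> n; have [m nm [_ vm]] := xio n; exists m.
by have [m _ [<- <-]] := xio 0%N; rewrite v'S.
Qed.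

End infinitely_often.

Lemma card_image_inj (U : choiceType) (f : U -> U) (A : set U) n :
  (A #= `I_n)%card -> (f @` A #= `I_n)%card -> {in A &, injective f}.
Proof.
move=> An fAn x y /set_mem Ax /set_mem Ay fxy; apply: contrapT => xy.
have finA : finite_set A by apply/finite_setP; exists n.
have n0 : (0 < n)%N.
  rewrite lt0n; apply/eqP => n0; move: An; rewrite n0 II0 card_eq0 => /eqP A0.
  by rewrite A0 in Ax.
have AyE : (A `\ y #= `I_n.-1)%card.
  have finAy : finite_set (A `\ y) by exact: finite_setD.
  rewrite -(fset_setK finAy); apply/card_eq_fsetP; rewrite fset_setD1 //.
  have := finmap.cardfsD1 y (fset_set A); rewrite (card_fset_set An) in_fset_set //.
  by rewrite mem_set //= add1n => ->.
have : (`I_n #<= `I_n.-1)%card.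
  rewrite -(card_le_eql fAn) -(card_le_eqr AyE).
  apply: card_le_trans (card_image_le f (A `\ y)).
  apply: subset_card_le => _ [z Az <-].
  have [->|zy] := pselect (z = y); last by exists z.
  by exists x => //; split=> // yx; apply: xy.
by rewrite card_le_II; case: (n) n0 => //= k _; rewrite ltnn.
Qed.

(** * The backward scheme and weak solvability *)

Section backward_scheme.
Context {R : realType} {E : completePseudoMetricType R} (E_polish : polish E).
Context {d : measure_display} {T : measurableType d}.
Context (P : probability T R) (theta thetaV : T -> T).
Context (dyn : dynamical_system P theta thetaV) (erg : ergodic P theta).
Context (phi : T -> E -> E) (phi_meas : random_map phi).

(** The recursion started from [Z] at time [-n] and observed at time [0]. *)
Definition backward_scheme (Z : T -> E) (n : nat) (w : T) : E :=
  forward theta phi Z n (iter n thetaV w).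

Lemma backward_schemeS Z n w :
  backward_scheme Z n.+1 (theta w) = phi w (backward_scheme Z n w).
Proof.
rewrite /backward_scheme (iterVS dyn) /=; congr (phi _ _).
by have [_ thetaVK _ _ _] := dyn; elim: n w => // n IHn w; rewrite iterSr /= thetaVK.
Qed.

Lemma measurable_backward_scheme Z n : random_var Z ->
  random_var (backward_scheme Z n).
Proof.
move=> mZ; have [_ _ mth mthV _] := dyn.
have mF : measurable_fun setT (forward theta phi Z n : T -> borel E).
  elim: n => [|n IHn]; first exact: mZ.
  apply: (measurableT_comp (f := fun p : T * borel E => phi p.1 p.2 : borel E)
    (g := fun w => (iter n theta w, forward theta phi Z n w : borel E))) => //.
  by apply/measurable_fun_pairP; split; [exact: measurable_iter|].
exact: measurableT_comp mF (measurable_iter n mthV).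
Qed.

(** Strict invariance makes every term of the decreasing intersection equal to
    [G w]. *)
Lemma backward_limit_set_invariant (G : T -> set E) :
  (forall w, phi w @` G w = G (theta w)) -> backward_limit_set thetaV phi G = G.
Proof.
have [_ thetaVK _ _ _] := dyn => phiG.
have im n w : backward thetaV phi n w @` G (iter n thetaV w) = G w.
  elim: n => [|n IHn]; first by rewrite /= image_id.
  rewrite -[RHS]IHn -[X in _ = _ @` G X]thetaVK -phiG.
  by apply/seteqP; split=> [_ [x Gx <-]|_ [_ [x Gx <-] <-]];
    [exists (phi (iter n.+1 thetaV w) x) => //; exists x|exists x].
apply/funext => w; apply/seteqP; split => [x /(_ 1%N isT)|x Gx n _];
  by rewrite im.
Qed.

(** The values taken infinitely often by the backward scheme form a finite set
    that [phi] maps onto the one at the next time. Its cardinality can therefore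
    only decrease, so it is constant by ergodicity and [phi] acts bijectively. *)
Lemma weak_solvability_finite_range (Z : T -> E) : random_var Z ->
  {ae P, forall w, finite_set (range (fun n => backward_scheme Z n w))} ->
  weak_solvability P theta thetaV phi.
Proof.
move=> mZ finV; set V := backward_scheme Z in finV.
have mV n : random_var (V n) by exact: measurable_backward_scheme.
have [Om [mO PO Oinv Ofin]] := ae_invariant_core dyn finV.
pose L w := values_io (V ^~ w).
have LO w : Om w -> phi w @` L w = L (theta w).
  move=> /Ofin fin; apply: image_values_io => // n.
  exact: backward_schemeS.
pose trace (Om' : set T) w : set E := [set x | Om' w /\ L w x].
have traceV Om' w : trace Om' w `<=` range (V ^~ w).
  by move=> x [_ /values_io_range].
have mtrace Om' : measurable Om' -> forall n, measurable [set w | trace Om' w (V n w)].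
  move=> mO' n; apply: measurableI => //.
  rewrite [X in measurable X](_ : _ = \bigcap_k \bigcup_(m in [set m | (k <= m)%N])
      [set w | V m w = V n w]).
    apply: bigcapT_measurable => k; apply: bigcup_measurable => m _.
    exact: (measurable_eq_borel E_polish (mV m) (mV n)).
  apply/seteqP; split=> w Lw k; first by move=> _; have [m km vm] := Lw k; exists m.
  by have [m km vm] := Lw k I; exists m.
(* The cardinality does not increase along orbits, so [A k] is mapped into itself and
   obeys the zero-one law; [c] is the least [k] for which it has probability 1. *)
pose A k := Om `&` [set w | (counting (trace Om w) <= k%:R%:E :> \bar R)%E].
have mA k : measurable (A k).
  apply: measurableI => //; rewrite -[X in measurable X]setTI.
  apply: emeasurable_fun_le => //.
  have := measurable_card_enumerated E_polish mV (traceV Om) (mtrace Om mO) measurableT.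
  by under eq_fun do rewrite setIT.
have AE k w : A k w <-> Om w /\ (L w #<= `I_k)%card.
  rewrite /A /= counting_le_II; split=> -[Ow le]; split=> //; move: le;
    by rewrite (_ : trace Om w = L w) //; apply/seteqP; split=> x // [].
have A01 k : P (A k) = 0%E \/ P (A k) = 1%E.
  apply: (zero_one_subinvariant dyn erg) => // w /AE [Ow Lk]; apply/AE.
  split; first by have [+ _] := Oinv w; apply.
  by rewrite -LO //; exact: card_le_trans (card_image_le _ _) Lk.
have exk : exists k, `[< P (A k) = 1%E >].
  apply: contrapT => /forallNP no1.
  have : P.-negligible (\bigcup_k A k).
    apply: negligible_bigcup => k; apply/negligibleP => //.
    by have [//|A1] := A01 k; have := no1 k; rewrite asboolT.
  rewrite (_ : \bigcup_k A k = Om).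
    move/(measure_negligible mO) => O0; move: PO.
    by rewrite O0 => /eqP; rewrite eq_sym onee_eq0.
  apply/seteqP; split=> w; first by move=> [k _ [Ow _]].
  move=> Ow; have := sub_finite_set (@values_io_range _ _) (Ofin _ Ow).
  by move=> /finite_set_leP [k Lk]; exists k => //; apply/AE.
pose c := ex_minn exk.
have [Ac cmin] : P (A c) = 1%E /\ forall k, P (A k) = 1%E -> (c <= k)%N.
  rewrite /c; case: ex_minnP => m /asboolP Am mmin; split=> // k Ak.
  by apply: mmin; exact/asboolP.
have c0 : (0 < c)%N.
  rewrite lt0n; apply/eqP => c0; move: Ac; rewrite c0 (_ : A 0%N = set0).
    by rewrite measure0 => /eqP; rewrite eq_sym onee_eq0.
  apply/seteqP; split => // w /AE [/Ofin /values_io_nonempty [x Lx]].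
  by rewrite II0 card_le0 => /eqP L0; have : L w x by []; rewrite L0.
have Lc : {ae P, forall w, Om w /\ (L w #= `I_c)%card}.
  have Ac1 : P (~` A c.-1) = 1%E.
    have [A0|/cmin] := A01 c.-1; last by rewrite leqNgt prednK // leqnn.
    by rewrite probability_setC // A0 sube0.
  have := ae_measure1 (measurableC (mA c.-1)) Ac1.
  apply: filterS2 (ae_measure1 (mA c) Ac) => w /AE [Ow Lw] nA; split=> //.
  have /finite_setP [m Lm] : finite_set (L w) by apply/finite_set_leP; exists c.
  suff -> : c = m by [].
  apply/eqP; rewrite eqn_leq; move: Lw; rewrite (card_le_eql Lm) card_le_II => ->.
  rewrite andbT leqNgt; apply/negP => mc; apply: nA; apply/AE; split=> //.
  by rewrite (card_le_eql Lm) card_le_II -ltnS prednK.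
have [Om' [mO' PO' Om'inv Om'L]] := ae_invariant_core dyn Lc.
pose G := trace Om'.
have phiG w : phi w @` G w = G (theta w).
  apply/seteqP; split => [_ [x [Ow Lx] <-]|y [Ow]].
    split; first by have [+ _] := Om'inv w; apply.
    by have [Ow' _] := Om'L _ Ow; rewrite -LO //; exists x.
  have {}Ow : Om' w by have [_] := Om'inv w; apply.
  by have [Ow' _] := Om'L _ Ow; rewrite -LO // => -[x Lx <-]; exists x.
have GE w : Om' w -> G w = L w by move=> Ow; apply/seteqP; split=> x // [].
have phi_inj w : {in G w &, injective (phi w)}.
  have [Ow|nOw] := pselect (Om' w); last by move=> x y /set_mem [].
  have Ow1 : Om' (theta w) by have [+ _] := Om'inv w; apply.
  apply: (@card_image_inj _ _ _ c); first by rewrite GE //; have [] := Om'L _ Ow.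
  by rewrite phiG GE //; have [] := Om'L _ Ow1.
have Gc : {ae P, forall w, (G w #= `I_c)%card}.
  apply: filterS (ae_measure1 mO' PO') => w Ow.
  by rewrite GE //; have [] := Om'L _ Ow.
have HG : backward_limit_set thetaV phi G = G.
  exact: backward_limit_set_invariant.
(* Emptiness outside of [Om'] makes this event exactly [Om'], hence measurable. *)
have finne : [set w | finite_set (G w) /\ G w !=set0] = Om'.
  apply/seteqP; split => w; first by move=> [_ [x []]].
  move=> Ow; rewrite /= GE //; have [Ow1 _] := Om'L _ Ow; split.
    exact: sub_finite_set (@values_io_range _ _) (Ofin _ Ow1).
  exact: values_io_nonempty (Ofin _ Ow1).
have mG := mtrace Om' mO'.
exists G; rewrite HG; split.
- exact: (random_set_enumerated E_polish mV (traceV Om') mG).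
- by apply: aeW => w; rewrite phiG.
- exact: (measurable_card_enumerated E_polish mV (traceV Om') mG).
- by rewrite finne PO'; split=> //; exact: lte01.
- have [w0 Ow0] : Om' !=set0.
    apply/set0P/eqP => O0; move: PO'; rewrite O0 measure0 => /eqP.
    by rewrite eq_sym onee_eq0.
  have [x0 Gx0] : G w0 !=set0.
    by rewrite GE //; have [/Ofin/values_io_nonempty] := Om'L _ Ow0.
  pose z0 : graph_type G := exist (fun p : T * borel E => G p.1 p.2) (w0, x0) Gx0.
  exact: (carried_extension E_polish dyn phi_meas mV (traceV Om') mG phiG phi_inj c0 Gc z0).
Qed.

End backward_scheme.

(** * Coupling of backward schemes *)

Section backward_scheme_theory.
Context {R : realType} {E : completePseudoMetricType R} (E_polish : polish E).
Context {d : measure_display} {T : measurableType d}.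
Context (P : probability T R) (theta thetaV : T -> T).
Context (dyn : dynamical_system P theta thetaV) (erg : ergodic P theta).
Context (phi : T -> E -> E) (phi_meas : random_map phi).

Local Notation scheme := (backward_scheme theta thetaV phi).
Local Notation coupling := (strong_backwards_coupling P theta thetaV phi).

Lemma invariant_iterV (Om : set T) n w : (forall w, Om w <-> Om (theta w)) ->
  Om w -> Om (iter n thetaV w).
Proof.
have [_ thetaVK _ _ _] := dyn => Ominv; elim: n => // n IHn /IHn Omw.
by apply/Ominv; rewrite iterS thetaVK.
Qed.

Lemma backward_scheme_stable (Z : T -> E) (Om : set T) (A : T -> set E) :
  (forall w, Om w <-> Om (theta w)) ->
  (forall w x, Om w -> A w x -> A (theta w) (phi w x)) ->
  (forall w, Om w -> A w (Z w)) ->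
  forall n w, Om w -> A w (scheme Z n w).
Proof.
have [_ thetaVK _ _ _] := dyn => Ominv Aphi AZ.
elim=> [w /AZ //|n IHn w Omw].
have Omv := @invariant_iterV _ 1 w Ominv Omw.
rewrite -[w]thetaVK (backward_schemeS dyn); apply: Aphi => //.
exact: IHn.
Qed.

Lemma backward_schemeD (Z : T -> E) n m w :
  scheme Z (n + m) w = backward thetaV phi n w (scheme Z m (iter n thetaV w)).
Proof.
have [_ thetaVK _ _ _] := dyn; elim: n m => // n IHn m.
rewrite addSnnS IHn [RHS]/=; congr (backward _ _ _ _ _).
by rewrite -[X in scheme Z m.+1 X]thetaVK (backward_schemeS dyn).
Qed.

Lemma finite_range_eventually (U : choiceType) (v : nat -> U) (A : set U) N :
  finite_set A -> (forall m, (N <= m)%N -> A (v m)) -> finite_set (range v).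
Proof.
move=> finA vA; apply: (@sub_finite_set _ _ (v @` `I_N `|` A)).
  move=> _ [m _ <-]; case: (ltnP m N) => mN; [by left; exists m|by right; exact: vA].
by rewrite finite_setU; split => //; exact/finite_image/finite_II.
Qed.

Lemma solution_scheme (X : T -> E) : solution P theta phi X ->
  {ae P, forall w, forall n, scheme X n w = X w}.
Proof.
move=> [mX Xphi]; have [Om [mOm POm Ominv OmX]] := ae_invariant_core dyn Xphi.
apply: filterS (ae_measure1 mOm POm) => w Omw n.
apply: (backward_scheme_stable (A := fun w => [set X w]) Ominv) => // u x Omu ->.
by rewrite /= OmX.
Qed.

(** At a rank beyond both coupling times, [X (theta w) = phi w (X w)] is the
    recursion satisfied by the scheme. *)
Lemma coupling_solution (Z X : T -> E) : random_var X -> coupling Z X ->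
  solution P theta phi X.
Proof.
move=> mX [N [_ NX]]; split => //.
have [Om [mOm POm Ominv OmN]] := ae_invariant_core dyn NX.
apply: filterS (ae_measure1 mOm POm) => w Omw.
have Omw1 : Om (theta w) by have [+ _] := Ominv w; apply.
pose n := maxn (N w) (N (theta w)).
rewrite -(OmN _ Omw n) ?leq_maxl // -(OmN _ Omw1 n.+1); last first.
  by apply: leqW; exact: leq_maxr.
exact: (backward_schemeS dyn).
Qed.

Lemma coupling_weak_solvability (Z X : T -> E) : random_var Z -> coupling Z X ->
  weak_solvability P theta thetaV phi.
Proof.
move=> mZ [N [_ NX]].
apply: (weak_solvability_finite_range E_polish dyn erg phi_meas mZ).
apply: filterS NX => w NXw.
exact: (finite_range_eventually (finite_set1 (X w)) NXw).
Qed.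

Lemma coupling_unique (Z X X' : T -> E) : coupling Z X -> coupling Z X' ->
  {ae P, forall w, X' w = X w}.
Proof.
move=> [N [_ NX]] [N' [_ NX']]; apply: filterS2 NX NX' => w Xw X'w.
by rewrite -(Xw (maxn (N w) (N' w))) ?leq_maxl // X'w ?leq_maxr.
Qed.

(** The visit time is set to [0] on the points that have never visited [C]. *)
Lemma measurable_first_visit (C : set T) : measurable C ->
  exists N : T -> nat, measurable_fun setT N /\
    forall w, (exists n, C (iter n thetaV w)) -> C (iter (N w) thetaV w).
Proof.
have [_ _ _ mthV _] := dyn => mC.
pose first n := [set w | C (iter n thetaV w) /\
  forall j, (j < n)%N -> ~ C (iter j thetaV w)].
have mfirst n : measurable (first n).
  apply: measurableI.
    exact: measurable_preimage (measurable_iter n mthV) mC.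
  rewrite [X in measurable X](_ : _ =
    \bigcap_(j in [set j | (j < n)%N]) ~` (iter j thetaV @^-1` C)).
    apply: bigcap_measurableType => j _; apply: measurableC.
    exact: measurable_preimage (measurable_iter j mthV) mC.
  by apply/seteqP; split=> w fw j /fw.
have first_fun w m n : first m w -> first n w -> m = n.
  move=> [Cm nm] [Cn nn]; case: (ltngtP m n) => // [mn|nm'].
    by case: (nn _ mn).
  by case: (nm _ nm').
have exN w : exists n, first n w \/ ((forall n, ~ first n w) /\ n = 0%N).
  have [[n fn]|/forallNP nf] := pselect (exists n, first n w).
    by exists n; left.
  by exists 0%N; right.
have [N NP] := choice exN; exists N; split; last first.
  move=> w [n Cn]; have [[//]|[nf _]] := NP w.
  have ex : exists n, `[< C (iter n thetaV w) >] by exists n; exact/asboolP.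
  case: (nf (ex_minn ex)); case: ex_minnP => m /asboolP Cm mmin; split=> // j jm Cj.
  by have := mmin j (asboolT Cj); rewrite leqNgt jm.
have N_eq n : N @^-1` [set n] = first n `|`
    (if n == 0%N then \bigcap_m ~` first m else set0).
  apply/seteqP; split => w.
    move=> <-; have [fN|[nf ->]] := NP w; first by left.
    by right; rewrite eqxx => m _; exact: nf.
  move=> [fn|]; have [fN|[nf N0]] := NP w.
  - exact: first_fun fN fn.
  - by case: (nf n).
  - by case: eqP => // _ /(_ (N w) I).
  - by case: eqP => // -> _.
move=> _ A _; rewrite setTI.
rewrite [X in measurable X](_ : _ = \bigcup_(n in A) (N @^-1` [set n])).
  apply: bigcup_measurable => n _; rewrite N_eq; apply: measurableU => //.
  case: eqP => // _; apply: bigcapT_measurable => m; exact: measurableC.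
by apply/seteqP; split=> [w Aw|w [n An /= Nw]];
  [exists (N w)|rewrite /preimage /= Nw].
Qed.

(** Each past visit to [C] is a renovation: all the schemes started from [GG] at
    least [p] steps before the visit agree there, hence at time [0] as well. *)
Lemma renovation_coupling (C : set T) p (GG : set (T -> E)) :
  measurable C -> (0 < P C)%E -> GG !=set0 -> (forall Z, GG Z -> random_var Z) ->
  (forall Z Z', GG Z -> GG Z' -> {ae P, forall w, C w ->
     forall m, (p <= m)%N -> scheme Z m w = scheme Z' p w}) ->
  exists X, solution P theta phi X /\ forall Z, GG Z -> coupling Z X.
Proof.
move=> mC PC [Z0 GZ0] mGG merge.
have [N [mN NP]] := measurable_first_visit mC.
pose X w := scheme Z0 (N w + p) w.
have mX : random_var X.
  move=> _ A mA; rewrite setTI.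
  rewrite [X in measurable X](_ : _ = \bigcup_n
      (N @^-1` [set n] `&` scheme Z0 (n + p) @^-1` A)).
    apply: bigcupT_measurable => n; apply: measurableI.
      exact: measurable_preimage.
    apply: measurable_preimage mA.
    by apply: (measurable_backward_scheme dyn phi_meas); exact: mGG.
  by apply/seteqP; split=> [w Aw|w [n _ [/= Nw Vw]]];
    [exists (N w)|rewrite /preimage /= /X Nw].
have GX Z : GG Z -> coupling Z X.
  move=> GZ; exists (fun w => N w + p)%N; split.
    move=> _ A _; rewrite setTI.
    exact: (measurable_preimage (A := [set n | A (n + p)%N]) mN).
  have [Om [mOm POm Ominv Omm]] := ae_invariant_core dyn (merge _ _ GZ GZ0).
  apply: filterS2 (ae_measure1 mOm POm) (ae_backward_visit dyn erg mC PC).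
  move=> w Omw /NP CN n Nn.
  rewrite -/(scheme Z n w) -(subnKC (leq_trans (leq_addr p (N w)) Nn)).
  rewrite /X !backward_schemeD; congr (backward _ _ _ _ _).
  by apply: Omm => //; [exact: invariant_iterV|rewrite -(addKn (N w) p) leq_sub2r].
exists X; split => //; exact: coupling_solution mX (GX _ GZ0).
Qed.

End backward_scheme_theory.

(** * Criteria for solvability *)

Section solvability_criteria.
Context {R : realType} {E : completePseudoMetricType R} (E_polish : polish E).
Context (W : topologicalType) (iota : E -> W) (iota_emb : dense_embedding iota).
Context (le : rel E) (le_po : partial_order le).
Context (zero : E) (zero_min : forall x, le zero x).
Context (le_cvg : increasing_converge iota le).
Context {d : measure_display} {T : measurableType d}.
Context (P : probability T R) (theta thetaV : T -> T).
Context (dyn : dynamical_system P theta thetaV) (erg : ergodic P theta).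
Context (phi : T -> E -> E) (phi_meas : random_map phi).

Local Notation scheme := (backward_scheme theta thetaV phi).
Local Notation coupling := (strong_backwards_coupling P theta thetaV phi).
Local Notation weakly_solvable := (weak_solvability P theta thetaV phi).

Let weak_of_finite_range :=
  weak_solvability_finite_range E_polish dyn erg phi_meas.

Lemma random_var_cst (x : E) : @random_var R E d T (fun=> x).
Proof. exact: measurable_cst. Qed.

Lemma finite_stable_weak_solvability (F : set E) : finite_set F -> F !=set0 ->
  as_stable P phi F -> weakly_solvable.
Proof.
move=> finF [x Fx] stF; apply: (weak_of_finite_range (random_var_cst x)).
have [Om [mOm POm Ominv OmF]] := ae_invariant_core dyn stF.
apply: filterS (ae_measure1 mOm POm) => w Omw.
apply: sub_finite_set finF => _ [n _ <-].
apply: (backward_scheme_stable dyn (A := fun=> F) Ominv) => // u y Omu Fy.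
by apply: (OmF _ Omu); exists y.
Qed.

(** Loynes' construction: the scheme started from the least point increases, and
    continuity of [phi] makes its limit a solution. *)
Lemma loynes_solution : {ae P, forall w, continuous (phi w)} ->
  {ae P, forall w, nondecreasing_map le (phi w)} ->
  loynes_limit_proper P thetaV iota zero phi -> exists X, solution P theta phi X.
Proof.
move=> phic phim proper; have [_ thetaVK _ _ _] := dyn.
have [_ iota_inj iota_open _] := iota_emb.
have [Om [mOm POm Ominv Omgood]] : exists O : set T, [/\ measurable O, P O = 1%E,
    (forall w, O w <-> O (theta w)) & forall w, O w ->
    [/\ continuous (phi w), nondecreasing_map le (phi w) &
      forall y : W, (fun n => iota (backward thetaV phi n w zero)) @ \oo --> y ->
        range iota y]].
  apply: (ae_invariant_core dyn).
  by apply: filterS3 phic phim proper => w ? ? ?; split.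
pose V := scheme (fun=> zero).
have VE n w : V n w = backward thetaV phi n w zero.
  by rewrite /V -[n]addn0 (backward_schemeD dyn) addn0.
have Vmono n w : Om w -> le (V n w) (V n.+1 w).
  elim: n w => [|n IHn] w Omw; first exact: zero_min.
  have Omv := @invariant_iterV _ _ _ _ _ _ dyn _ 1 w Ominv Omw.
  rewrite -[w]thetaVK /V !(backward_schemeS dyn phi).
  by have [_ mono _] := Omgood _ Omv; apply/mono/IHn.
have lim w : exists x : E, (Om w -> V ^~ w @ \oo --> x) /\ (~ Om w -> x = zero).
  have [Omw|nOm] := pselect (Om w); last by exists zero.
  have [y Vy] := le_cvg (fun n => Vmono n w Omw).
  have [_ _ /(_ y) [|x _ xy]] := Omgood _ Omw.
    rewrite (_ : (fun n => _) = iota \o (V ^~ w)) //.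
    by apply/funext => n; rewrite /= VE.
  exists x; split => // _ A; rewrite nbhsE => -[U [oU Ux] UA].
  have [/iota_open [B oB BU] _] := (conj oU I).
  have : nbhs y B.
    by apply: open_nbhs_nbhs; split => //; rewrite -xy; move: Ux; rewrite BU.
  by move=> /Vy [N _ VB]; exists N => // n Nn; apply: UA; rewrite BU; exact: VB.
have [X XP] := choice lim; exists X.
have mV n : random_var (V n).
  by apply: (measurable_backward_scheme dyn phi_meas); exact: random_var_cst.
split; last first.
  apply: filterS (ae_measure1 mOm POm) => w Omw.
  have Omw1 : Om (theta w) by have [+ _] := Ominv w; apply.
  have [/(_ Omw) Xw _] := XP w; have [/(_ Omw1) Xw1 _] := XP (theta w).
  have phiXw : V ^~ (theta w) @ \oo --> phi w (X w).
    rewrite -(cvg_shiftS (V ^~ (theta w))).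
    rewrite (_ : (fun n => V n.+1 (theta w)) = phi w \o V ^~ w).
      by have [phicw _ _] := Omgood _ Omw; exact: continuous_cvg (phicw _) Xw.
    by apply/funext => n; rewrite /= /V (backward_schemeS dyn phi).
  have [hE _] := E_polish; exact: (cvg_unique hE Xw1 phiXw).
(* Off [Om] the scheme is replaced by [zero], so that it converges everywhere. *)
pose V' n w : borel E := if w \in Om then V n w else zero.
apply: (measurable_fun_cvg_borel E_polish (V := V')).
  move=> n; apply: measurable_fun_ifT; [|exact: mV|exact: measurable_cst].
  apply: (measurable_fun_bool true); rewrite setTI.
  by rewrite [X in measurable X](_ : _ = Om) //; apply/seteqP; split=> w;
    [exact: set_mem|exact: mem_set].
move=> w; have [Xw Xzero] := XP w; rewrite /V'.
have [Omw|nOm] := pselect (Om w); first by rewrite mem_set //; exact: Xw.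
by rewrite memNset // Xzero //; exact: cvg_cst.
Qed.

Lemma solution_weak_solvability X : solution P theta phi X -> weakly_solvable.
Proof.
move=> solX; have [mX _] := solX; apply: (weak_of_finite_range mX).
apply: filterS (solution_scheme dyn solX) => w Xw.
by apply: (finite_range_eventually (finite_set1 (X w)) (N := 0%N)) => n _; exact: Xw.
Qed.

(** The part of [E] below [Y] is carried along by [phi], because
    [phi x <= psi x <= psi Y] whenever [x <= Y]. *)
Lemma dominated_scheme (psi : T -> E -> E) (Y Z : T -> E) :
  dominating P le zero phi psi -> solution P theta psi Y ->
  {ae P, forall w, le (Z w) (Y w)} ->
  {ae P, forall w, forall n, le (scheme Z n w) (Y w)}.
Proof.
move=> [_ dom mono _] [_ Yeq] ZY; have [_ _ le_trans] := le_po.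
have [Om [mOm POm Ominv Omgood]] : exists O : set T, [/\ measurable O, P O = 1%E,
    (forall w, O w <-> O (theta w)) & forall w, O w ->
    le (Z w) (Y w) /\ forall x, le x (Y w) -> le (phi w x) (Y (theta w))].
  apply: (ae_invariant_core dyn).
  apply: filterS3 dom mono (filterI ZY Yeq) => w domw monow [ZYw Yeqw]; split=> // x xY.
  have [_ phipsi] := domw x; apply: le_trans phipsi _.
  by rewrite Yeqw; exact: monow.
apply: filterS (ae_measure1 mOm POm) => w Omw n.
apply: (backward_scheme_stable dyn (A := fun w => [set x | le x (Y w)]) Ominv) => //.
  by move=> u x /Omgood [_]; apply.
by move=> u /Omgood [].
Qed.

(** Wherever [Y] hits the least point, it crushes every scheme below it. *)
Lemma dominated_coupling (psi : T -> E -> E) (Y : T -> E) :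
  dominating P le zero phi psi -> solution P theta psi Y ->
  (0 < P [set w | le (Y w) zero])%E ->
  exists X, solution P theta phi X /\ forall Z, random_var Z ->
    {ae P, forall w, le (Z w) (Y w)} -> coupling Z X.
Proof.
move=> dom solY PY; have [mY _] := solY; have [_ le_anti le_trans] := le_po.
have le0 x : le x zero -> x = zero.
  by move=> x0; apply: le_anti; rewrite x0 zero_min.
have mY0 : measurable [set w | le (Y w) zero].
  rewrite [X in measurable X](_ : _ = [set w | Y w = zero]).
    exact: (measurable_eq_borel E_polish mY (random_var_cst zero)).
  by apply/seteqP; split=> w /= => [/le0 //|->]; exact: zero_min.
pose GG := [set Z : T -> E | random_var Z /\ {ae P, forall w, le (Z w) (Y w)}].
have [||Z Z' [mZ ZY] [mZ' Z'Y]|X [solX GX]] :=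
    renovation_coupling dyn erg phi_meas (p := 0) (GG := GG) mY0 PY.
- by exists (fun=> zero); split; [exact: random_var_cst|exact: aeW].
- by move=> Z [].
- have ZV := dominated_scheme dom solY ZY; have Z'V := dominated_scheme dom solY Z'Y.
  apply: filterS2 ZV Z'V => w Zw Z'w Yw m _.
  have Zw0 := le0 _ (le_trans _ _ _ (Zw m) Yw).
  have Z'w0 := le0 _ (le_trans _ _ _ (Z'w 0%N) Yw).
  exact: etrans Zw0 (esym Z'w0).
by exists X; split => // Z mZ ZY; exact: GX.
Qed.

(** The scheme started from [zero] lies in the intersection of [L] with the
    compact closure of the points below [Y w]. *)
Lemma locally_finite_weak_solvability : (forall y, precompact [set x | le x y]) ->
  H1 P theta le zero phi -> H3 P zero phi -> weakly_solvable.
Proof.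
move=> cpt [psi [dom [Y solY]]] [_ [L [Lfin L0 Lst]]].
apply: (weak_of_finite_range (random_var_cst zero)).
have ZY : {ae P, forall w, le zero (Y w)} by exact: aeW.
have [Om [mOm POm Ominv OmL]] := ae_invariant_core dyn Lst.
apply: filterS2 (ae_measure1 mOm POm) (dominated_scheme dom solY ZY) => w Omw VY.
have : compact (closure [set x | le x (Y w)]) by rewrite -precompactE; exact: cpt.
move=> /Lfin; apply: sub_finite_set => _ [n _ <-]; split.
  apply: (backward_scheme_stable dyn (A := fun=> L) Ominv) => // u x Omu Lx.
  by apply: (OmL _ Omu); exists x.
exact/subset_closure/VY.
Qed.

(** After a visit to [BB] at time [-n], the tail of the scheme at time [0] is the
    image of points of the finite set [B] by the single map [backward n]. *)
Lemma renovation_weak_solvability (Z : T -> E) p (B : T -> set E) (BB : set T) :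
  random_var Z -> (forall w, finite_set (B w)) -> measurable BB -> (0 < P BB)%E ->
  {ae P, forall w, BB w -> forall n, (p <= n)%N -> B w (scheme Z n w)} ->
  weakly_solvable.
Proof.
move=> mZ finB mBB PBB BZ; apply: (weak_of_finite_range mZ).
have [Om [mOm POm Ominv OmB]] := ae_invariant_core dyn BZ.
apply: filterS2 (ae_measure1 mOm POm) (ae_backward_visit dyn erg mBB PBB).
move=> w Omw [n BBn].
have finA := finite_image (backward thetaV phi n w) (finB (iter n thetaV w)).
apply: (finite_range_eventually finA (N := (n + p)%N)) => m npm.
rewrite -(subnKC (leq_trans (leq_addr p n) npm)) (backward_schemeD dyn).
exists (scheme Z (m - n) (iter n thetaV w)) => //.
apply: (OmB _ _ BBn); first exact: (invariant_iterV dyn).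
by rewrite -(addKn n p) leq_sub2r.
Qed.

(** Reading the condition from time [-n] instead of time [0] places the event and
    the set [B] at time [0] for all [n]. *)
Lemma renovation_scheme (Z : T -> E) p (B : T -> set E) (BB : set T) :
  (forall n, (p <= n)%N -> {ae P, forall w, BB (iter n theta w) ->
     B (iter n theta w) (forward theta phi Z n w)}) ->
  {ae P, forall w, BB w -> forall n, (p <= n)%N -> B w (scheme Z n w)}.
Proof.
move=> BZ; have : {ae P, forall w, forall n, (p <= n)%N -> BB (iter n theta w) ->
    B (iter n theta w) (forward theta phi Z n w)}.
  apply: ae_foralln => n; have [pn|] := boolP (p <= n)%N; last by move=> _; exact: aeW.
  by apply: filterS (BZ n pn) => w.
move=> /(ae_invariant_core dyn) [Om [mOm POm Ominv OmB]].
apply: filterS (ae_measure1 mOm POm) => w Omw BBw n pn.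
have := OmB _ (invariant_iterV dyn n Ominv Omw) n pn.
have [thetaK thetaVK _ _ _] := dyn.
have -> : iter n theta (iter n thetaV w) = w.
  by elim: (n) w {Omw BBw} => // k IHk w; rewrite iterSr /= thetaVK.
exact.
Qed.

Lemma singleton_renovation_coupling (GG : set (T -> E)) p (B : T -> set E)
    (BB : set T) : GG !=set0 -> (forall Z, GG Z -> random_var Z) ->
  measurable_card B -> measurable BB ->
  (forall Z, GG Z ->
     {ae P, forall w, BB w -> forall n, (p <= n)%N -> B w (scheme Z n w)}) ->
  (0 < P (BB `&` [set w | (B w #= `I_1)%card]))%E ->
  exists X, solution P theta phi X /\ forall Z, GG Z -> coupling Z X.
Proof.
move=> GG0 mGG mB mBB BZ PC.
have mB1 : measurable [set w | (B w #= `I_1)%card].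
  rewrite [X in measurable X](_ : _ =
      (fun w => counting (B w `&` setT) : \bar R) @^-1` [set 1%:E]).
    exact: measurable_preimage (mB _ measurableT) (emeasurable_set1 _).
  apply/seteqP; split=> w /=; rewrite setIT; first exact: counting_card_II.
  move=> B1; have : (B w #<= `I_1)%card by rewrite -(counting_le_II (R := R)) B1.
  have B0 : ~ (B w #<= `I_0)%card.
    by rewrite -(counting_le_II (R := R)) B1 lee_fin ler10.
  move=> Bw; have /finite_setP [m Bm] : finite_set (B w).
    by apply/finite_set_leP; exists 1%N.
  move: Bw B0; rewrite !(card_le_eql Bm) !card_le_II.
  by case: m Bm => [|[|m]].
apply: (renovation_coupling dyn erg phi_meas (p := p) _ PC GG0 mGG).
  exact: measurableI.
move=> Z Z' /BZ BZ1 /BZ BZ2; apply: filterS2 BZ1 BZ2 => w Zw Z'w [BBw B1] m pm.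
have Bm := Zw BBw m pm; have Bp := Z'w BBw p (leqnn p).
have /eq_cardSP [x _] := B1; rewrite II0 card_eq0 => /eqP Bx.
have eqx y : B w y -> y = x.
  by move=> By; apply: contrapT => yx; have : (B w `\ x) y by []; rewrite Bx.
by rewrite (eqx _ Bm) (eqx _ Bp).
Qed.

End solvability_criteria.

(** * The five solvability cases *)

Theorem proposition3 (R : realType)
    (E : completePseudoMetricType R) (E_polish : polish E)
    (W : topologicalType) (iota : E -> W) (iota_emb : dense_embedding iota)
    (le : rel E) (le_po : partial_order le)
    (zero : E) (zero_min : forall x, le zero x)
    (le_cvg : increasing_converge iota le)
    (d : measure_display) (T : measurableType d) (P : probability T R)
    (theta thetaV : T -> T) (theta_dyn : dynamical_system P theta thetaV)
    (theta_erg : ergodic P theta)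
    (phi : T -> E -> E) (phi_meas : random_map phi) :
  [/\ (* i *)
      forall F : set E, finite_set F -> F !=set0 -> as_stable P phi F ->
        weak_solvability P theta thetaV phi,
      (* ii *)
      {ae P, forall w, continuous (phi w)} ->
      {ae P, forall w, nondecreasing_map le (phi w)} ->
      loynes_limit_proper P thetaV iota zero phi ->
        weak_solvability P theta thetaV phi,
      (* iii *)
      forall (psi : T -> E -> E) (Y : T -> E),
        dominating P le zero phi psi -> solution P theta psi Y ->
        (0 < P [set w | le (Y w) zero])%E ->
        weak_solvability P theta thetaV phi /\
        exists X : T -> E,
          [/\ solution P theta phi X,
              (forall Z : T -> E, random_var Z ->
                 {ae P, forall w, le (Z w) (Y w)} ->
                 strong_backwards_coupling P theta thetaV phi Z X),
              {ae P, forall w, le (X w) (Y w)},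
              (forall X' : T -> E, solution P theta phi X' ->
                 {ae P, forall w, le (X' w) (Y w)} ->
                 {ae P, forall w, X' w = X w})
            & (forall X' : T -> E, solution P theta phi X' ->
                 (forall Z : T -> E, random_var Z ->
                    {ae P, forall w, le (Z w) (Y w)} ->
                    strong_backwards_coupling P theta thetaV phi Z X') ->
                 {ae P, forall w, X' w = X w})],
      (* iv *)
      (forall y, precompact [set x | le x y]) ->
      H1 P theta le zero phi -> H3 P zero phi ->
        weak_solvability P theta thetaV phi
    & (* v *)
      forall (GG : set (T -> E)) (p : nat) (B : T -> set E) (BB : set T),
        GG !=set0 -> (forall Z, GG Z -> random_var Z) ->
        finite_random_set B -> measurable BB -> (0 < P BB)%E ->
        (forall Z, GG Z -> forall n, (p <= n)%N ->
           {ae P, forall w, BB (iter n theta w) ->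
              B (iter n theta w) (forward theta phi Z n w)}) ->
        weak_solvability P theta thetaV phi /\
        ((0 < P (BB `&` [set w | (B w #= `I_1)%card]))%E ->
         exists X : T -> E, solution P theta phi X /\
           forall Z, GG Z ->
             strong_backwards_coupling P theta thetaV phi Z X)].
Proof.
have weak_of_coupling :=
  coupling_weak_solvability E_polish theta_dyn theta_erg phi_meas.
split.
- exact: (finite_stable_weak_solvability E_polish theta_dyn theta_erg phi_meas).
- move=> phic phim proper.
  have [X solX] := loynes_solution E_polish iota_emb zero_min le_cvg theta_dyn
    phi_meas phic phim proper.
  exact: (solution_weak_solvability E_polish theta_dyn theta_erg phi_meas solX).
- move=> psi Y dom solY PY.
  have [X [solX GX]] := dominated_coupling E_polish le_po zero_min theta_dyn
    theta_erg phi_meas dom solY PY.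
  have mzero := @random_var_cst R E d T zero.
  have zeroY : {ae P, forall w, le zero (Y w)} by exact: aeW.
  split; first exact: weak_of_coupling mzero (GX _ mzero zeroY).
  exists X; split => //.
  + have [N [_ NX]] := GX _ mzero zeroY.
    have VY := dominated_scheme le_po theta_dyn dom solY zeroY.
    apply: filterS2 NX VY => w NXw VYw; rewrite -(NXw (N w)) //; exact: VYw.
  + move=> X' solX' X'Y; have [mX' _] := solX'; have [N [_ NX]] := GX _ mX' X'Y.
    have VX' := solution_scheme theta_dyn solX'.
    apply: filterS2 NX VX' => w NXw X'w; rewrite -(NXw (N w)) //.
    by rewrite -[LHS](X'w (N w)).
  + move=> X' solX' GX'.
    exact: coupling_unique (GX _ mzero zeroY) (GX' _ mzero zeroY).
- exact: (locally_finite_weak_solvability E_polish le_po zero_min theta_dyn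
    theta_erg phi_meas).
- move=> GG p B BB GG0 mGG [finB mB] mBB PBB BX.
  have BV Z (GZ : GG Z) := renovation_scheme theta_dyn (BX Z GZ).
  split; last first.
    exact: (singleton_renovation_coupling theta_dyn theta_erg phi_meas GG0 mGG
      mB mBB BV).
  have [Z GZ] := GG0.
  exact: (renovation_weak_solvability E_polish theta_dyn theta_erg phi_meas
    (mGG _ GZ) finB mBB PBB (BV _ GZ)).
Qed.
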